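(* Let $s>0$, $\beta>1$, $\gamma>0$ and let $\eta_N(z)=\eta_0\zeta(z/N)$, $z\in[0,N]$, be a fractional learning-rate schedule with power-decay tail of exponent $\gamma$ (constants $\delta\in(0,1)$ as in the definition). Let $\alpha=\min\{\beta,\gamma+1\}$ and $T_N=\eta_0N\int_0^1\zeta(x)dx$. Define $$\mathcal F[\eta_N]:=(1+T_N)^{-s}+\int_0^{T_N}\mathcal K(T_N-\tau)\varphi(\tau)\,d\tau,\qquad \mathcal K(u)=(1+u)^{-(2-1/\beta)},$$ where $\varphi(\tau)=\eta_N(z(\tau))$ is the learning rate in intrinsic time. Then for all $T_N\ge 2$, $$\mathcal F[\eta_N]\eqsim T_N^{-s}+\eta_0\,T_N^{-(1-\frac1\alpha)}\,(\log T_N)^{\mathbf 1\{\beta=\gamma+1\}},$$ with implicit constants depending only on $s,\beta,\zeta$ (not on $N$ or $\eta_0$).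
   Context: A fractional LRS with power-decay tail: $\eta_N(z)=\eta_0\zeta(z/N)$ with $\eta_0>0$ and a measurable profile $\zeta:[0,1]\to[0,1]$ with $\zeta(0)=1$, such that there exist $\gamma>0$, $\delta\in(0,1)$ with $\zeta(x)\eqsim(1-x)^\gamma$ for all $x\in[\delta,1]$. The intrinsic time is $t(z)=\int_0^z\eta_N(u)du$, so $T_N=t(N)$; $z(\cdot)$ denotes a generalized inverse of $t(\cdot)$ on $[0,T_N]$, and $\varphi(\tau):=\eta_N(z(\tau))$. $\mathbf 1\{\cdot\}$ is the indicator. $f\eqsim g$ means two-sided bounds up to positive multiplicative constants. *)

(* Defs.v *)
From HB Require Import structures.
From mathcomp Require Import all_boot all_order all_algebra.
From mathcomp Require Import all_classical all_reals all_analysis.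
Set Implicit Arguments. Unset Strict Implicit. Unset Printing Implicit Defensive.
Import Order.TTheory GRing.Theory Num.Theory.
Import numFieldNormedType.Exports.
Local Open Scope classical_set_scope.
Local Open Scope ring_scope.

Section LRS.
Variable R : realType.

Definition power_decay_profile (zeta : R -> R) (gamma delta : R) : Prop :=
  measurable_fun (`[0, 1] : set R) zeta /\
  (forall x, 0 <= x <= 1 -> 0 <= zeta x <= 1) /\
  zeta 0 = 1 /\
  exists c1 c2 : R, 0 < c1 /\ 0 < c2 /\
    forall x, delta <= x <= 1 ->
      c1 * (1 - x) `^ gamma <= zeta x /\ zeta x <= c2 * (1 - x) `^ gamma.

Definition etaN (zeta : R -> R) (eta0 : R) (N : nat) (z : R) : R :=
  eta0 * zeta (z / N%:R).

Definition intr_time (zeta : R -> R) (eta0 : R) (N : nat) (z : R) : R :=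
  \int[lebesgue_measure]_(u in (`[0, z] : set R)) etaN zeta eta0 N u.

Definition TN (zeta : R -> R) (eta0 : R) (N : nat) : R :=
  intr_time zeta eta0 N N%:R.

(* generalized (left-continuous) inverse of t on [0, T_N] *)
Definition zinv (zeta : R -> R) (eta0 : R) (N : nat) (tau : R) : R :=
  inf [set z : R | 0 <= z <= N%:R /\ tau <= intr_time zeta eta0 N z].

Definition phi (zeta : R -> R) (eta0 : R) (N : nat) (tau : R) : R :=
  etaN zeta eta0 N (zinv zeta eta0 N tau).

Definition kernelK (beta u : R) : R := (1 + u) `^ (- (2 - beta^-1)).

Definition riskF (s beta : R) (zeta : R -> R) (eta0 : R) (N : nat) : R :=
  let T := TN zeta eta0 N in
  (1 + T) `^ (- s) +
  \int[lebesgue_measure]_(tau in (`[0, T] : set R)) (kernelK beta (T - tau) * phi zeta eta0 N tau).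

Definition riskRHS (s beta gamma : R) (eta0 T : R) : R :=
  let alpha := Num.min beta (gamma + 1) in
  T `^ (- s) + eta0 * T `^ (- (1 - alpha^-1)) *
               (if beta == gamma + 1 then ln T else 1).

End LRS.

(* Main.v *)
Require Import Defs.
From HB Require Import structures.
From mathcomp Require Import all_boot all_order all_algebra.
From mathcomp Require Import all_classical all_reals all_analysis.
From mathcomp Require Import measurable_realfun ring lra.
Set Implicit Arguments. Unset Strict Implicit. Unset Printing Implicit Defensive.
Import Order.TTheory GRing.Theory Num.Theory.
Import numFieldNormedType.Exports.
Local Open Scope classical_set_scope.
Local Open Scope ring_scope.

(* Let [p = gamma / (gamma + 1)].  In the tail, with [y = 1 - z / N], the
   learning rate is comparable to [eta0 y^gamma] and the remaining intrinsic
   time [u = T - t(z)] to [eta0 N y^(gamma + 1)], while [T] is comparable to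
   [eta0 N].  Hence [phi tau] is comparable to [eta0 ((T - tau) / T)^p] for
   [tau] in a final segment of length proportional to [T]; the upper bound
   holds on all of [[0, T]] because elsewhere [(T - tau) / T] is bounded below.
   No change of variables is needed, and the integral reduces to that of
   [u^(q - 1)] with [q = 1 / beta - 1 / (gamma + 1)], whose sign separates the
   three regimes. *)

(** * Integrals of bounded functions over intervals *)

Section bounded_integrals.
Variable R : realType.
Notation mu := (@lebesgue_measure R).
Implicit Types (f : R -> R) (a b m M : R).

Lemma integrable_bounded_itv f (x y : bool) a b M
  (I := [set` Interval (BSide x a) (BSide y b)]) :
  measurable_fun I f -> (forall u, I u -> 0 <= f u <= M) ->
  mu.-integrable I (EFin \o f).
Proof.
move=> mf fM; apply: measurable_bounded_integrable => //.
- exact: measurable_itv.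
- rewrite /= /I lebesgue_measure_itv /=; case: ifP => _; last exact: ltry.
  by rewrite -EFinD ltry.
- exists M; split; first exact: num_real.
  move=> r Mr u Iu /=; have /andP[f0 fu] := fM _ Iu.
  by rewrite ger0_norm// (le_trans fu)// ltW.
Qed.

Lemma fine_lebesgue_measure_itvoc a b : a <= b -> fine (mu `]a, b]) = b - a.
Proof.
rewrite lebesgue_measure_itv /= lte_fin le_eqVlt => /predU1P[->|->] //.
by rewrite ltxx subrr.
Qed.

Lemma Rintegral_itvoc_le f a b M : a <= b -> measurable_fun `]a, b] f ->
  (forall u, a < u <= b -> 0 <= f u <= M) ->
  \int[mu]_(u in `]a, b]) f u <= M * (b - a).
Proof.
move=> ab mf fM; rewrite -(fine_lebesgue_measure_itvoc ab) -Rintegral_cst//.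
apply: le_Rintegral => //.
- by apply: (@integrable_bounded_itv _ _ _ _ _ M) => // u /=; rewrite in_itv /=; exact: fM.
- apply: (@integrable_bounded_itv _ _ _ _ _ M) => // u /=; rewrite in_itv /= => /fM.
  by case/andP => f0 /(le_trans f0) ->/=.
- by move=> u /=; rewrite in_itv /= => /fM /andP[].
Qed.

Lemma Rintegral_itvoc_ge f a b m M : a <= b -> measurable_fun `]a, b] f ->
  (forall u, a < u <= b -> 0 <= f u <= M) ->
  0 <= m -> (forall u, a < u <= b -> m <= f u) ->
  m * (b - a) <= \int[mu]_(u in `]a, b]) f u.
Proof.
move=> ab mf fM m0 fm; rewrite -(fine_lebesgue_measure_itvoc ab) -Rintegral_cst//.
apply: le_Rintegral => //.
- by apply: (@integrable_bounded_itv _ _ _ _ _ m) => // u _ /=; rewrite m0 lexx.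
- by apply: (@integrable_bounded_itv _ _ _ _ _ M) => // u /=; rewrite in_itv /=; exact: fM.
Qed.

Lemma ge0_le_Rintegral_subset f (A B : set R) : measurable A -> measurable B ->
  A `<=` B -> mu.-integrable B (EFin \o f) -> (forall u, B u -> 0 <= f u) ->
  \int[mu]_(u in A) f u <= \int[mu]_(u in B) f u.
Proof.
move=> mA mB AB fB f0; rewrite /Rintegral fine_le//.
- by apply: integrable_fin_num => //; exact: integrableS fB.
- exact: integrable_fin_num.
- by apply: ge0_subset_integral => //; exact: measurable_int fB.
Qed.

End bounded_integrals.

(** * Explicit integration of reflected powers *)

Section power_primitive.
Variable R : realType.
Notation mu := (@lebesgue_measure R).

(** A primitive of [u^(q - 1)] on the positive axis. Including the logarithm at [q = 0] lets the
    three regimes share one formula for the integral; only differences are used, so the additive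
    constant is immaterial. *)
Definition pow_primitive (q u : R) : R := if q == 0 then ln u else u `^ q / q.

Lemma is_derive_pow_primitive (q u : R) : 0 < u ->
  is_derive u 1 (pow_primitive q) (u `^ (q - 1)).
Proof.
move=> u0; rewrite /pow_primitive; case: eqVneq => [->|q0].
  by rewrite sub0r powR_inv1 ?ltW//; exact: is_derive1_ln.
have -> : u `^ (q - 1) = q^-1 *: (q * u `^ (q - 1)).
  by rewrite /GRing.scale /= mulKf.
have -> : (fun x : R => x `^ q / q) = q^-1 \*: (fun x : R => x `^ q).
  by apply/funext => x /=; rewrite mulrC.
by apply: is_deriveZ; exact: is_derive1_powR.
Qed.

Lemma is_derive_refl (m x : R) : is_derive x 1 (fun y : R => m - y) (- 1).
Proof.
have := @is_deriveB R R R (cst m) id x 1 0 1 (is_derive_cst _ _ _) (is_derive_id _ _).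
by rewrite sub0r.
Qed.

(** The reflection is there because the kernel depends on [T - tau]; the chain rule contributes a
    factor [-1], cancelled by the outer sign. *)
Lemma is_derive_pow_primitive_refl (q m x : R) : x < m ->
  is_derive x 1 (fun y => - pow_primitive q (m - y)) ((m - x) `^ (q - 1)).
Proof.
move=> xm.
have d2 : is_derive (m - x) 1 (pow_primitive q) ((m - x) `^ (q - 1)).
  by apply: is_derive_pow_primitive; rewrite subr_gt0.
have /is_deriveN := @is_derive1_comp _ (pow_primitive q) (fun y => m - y) x _ _ d2 (is_derive_refl m x).
by rewrite mulrN1 opprK.
Qed.

Lemma continuous_pow_refl (q m x : R) : x < m ->
  {for x, continuous (fun y => (m - y) `^ q)}.
Proof.
move=> xm; apply: differentiable_continuous; apply/derivable1_diffP.
have d2 : is_derive (m - x) 1 (fun y : R => y `^ q) (q * (m - x) `^ (q - 1)).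
  by apply: is_derive1_powR; rewrite subr_gt0.
by have [] := @is_derive1_comp _ (fun y : R => y `^ q) (fun y => m - y) x _ _ d2 (is_derive_refl m x).
Qed.

Lemma within_continuous_pow_refl (q m a b : R) : b < m ->
  {within `[a, b], continuous (fun y => (m - y) `^ q)}.
Proof.
move=> bm; apply: continuous_in_subspaceT => x.
rewrite inE/= in_itv/= => /andP[_ xb].
by apply: continuous_pow_refl; exact: le_lt_trans bm.
Qed.

Lemma integrable_pow_refl (q m a b : R) : b < m ->
  mu.-integrable `[a, b] (EFin \o (fun y => (m - y) `^ q)).
Proof.
move=> bm; apply: continuous_compact_integrable; first exact: segment_compact.
exact: within_continuous_pow_refl.
Qed.

Lemma integrable_scale_pow_refl (c q m a b : R) : b < m ->
  mu.-integrable `[a, b] (EFin \o (fun y => c * (m - y) `^ q)).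
Proof.
move=> bm; rewrite [X in mu.-integrable _ X](_ : _ =
    (fun y : R => (c%:E * ((m - y) `^ q)%R%:E)%E))//.
by apply: integrableZl => //; exact: integrable_pow_refl.
Qed.

(** The fundamental theorem of calculus applies because [b < m] keeps the interval away from the
    possible singularity at [m]. *)
Lemma Rintegral_pow_refl (q m a b : R) : a < b -> b < m ->
  \int[mu]_(x in `[a, b]) (m - x) `^ (q - 1) =
  pow_primitive q (m - a) - pow_primitive q (m - b).
Proof.
move=> ab bm.
have dF x : x < m -> {for x, continuous (fun y => - pow_primitive q (m - y))}.
  move=> xm; apply: differentiable_continuous; apply/derivable1_diffP.
  by have [] := is_derive_pow_primitive_refl q xm.
rewrite /Rintegral (@continuous_FTC2 _ _ (fun y => - pow_primitive q (m - y)))//.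
- by rewrite /= opprK addrC.
- exact: within_continuous_pow_refl.
- split.
  + move=> x; rewrite in_itv/= => /andP[_ xb].
    by have [] := is_derive_pow_primitive_refl q (lt_trans xb bm).
  + by apply: cvg_at_right_filter; apply: dF; exact: lt_trans bm.
  + by apply: cvg_at_left_filter; exact: dF.
- move=> x; rewrite in_itv/= => /andP[_ xb].
  by rewrite derive1E; have [_ ->] := is_derive_pow_primitive_refl q (lt_trans xb bm).
Qed.

End power_primitive.

(** * Intrinsic time: monotonicity and Lipschitz bound *)

Section intrinsic_time.
Variables (R : realType) (zeta : R -> R) (eta0 : R) (N : nat).
Hypothesis mzeta : measurable_fun (`[0, 1] : set R) zeta.
Hypothesis zeta01 : forall x, 0 <= x <= 1 -> 0 <= zeta x <= 1.
Hypotheses (N_gt0 : (0 < N)%N) (eta0_gt0 : 0 < eta0).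
Notation mu := (@lebesgue_measure R).
Let n : R := N%:R.
Let t := intr_time zeta eta0 N.
Let T := TN zeta eta0 N.

Let n_gt0 : 0 < n. Proof. by rewrite ltr0n. Qed.

Let div_n_itv z : 0 <= z <= n -> 0 <= z / n <= 1.
Proof.
case/andP => z0 zn; apply/andP; split; first by rewrite divr_ge0// ltW.
by rewrite ler_pdivrMr// mul1r.
Qed.

Lemma etaN_bounds z : 0 <= z <= n -> 0 <= etaN zeta eta0 N z <= eta0.
Proof.
move=> /div_n_itv/zeta01/andP[z0 z1]; rewrite /etaN; apply/andP; split.
  by rewrite mulr_ge0// ltW.
by rewrite ler_piMr// ltW.
Qed.

Lemma measurable_etaN : measurable_fun (`[0, n] : set R) (etaN zeta eta0 N).
Proof.
apply: measurable_funM; first exact: measurable_cst.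
rewrite -[X in measurable_fun _ X]/(zeta \o (fun z => z / n)).
apply: (@measurable_comp _ _ _ _ _ _ (`[0, 1] : set R)) => //.
  by move=> _ [z /= + <-]; rewrite !in_itv/=; exact: div_n_itv.
by apply: measurable_funM => //; exact: measurable_cst.
Qed.

Let measurable_etaN_oc a b : 0 <= a -> b <= n ->
  measurable_fun (`]a, b] : set R) (etaN zeta eta0 N).
Proof.
move=> a0 bn; apply: measurable_funS measurable_etaN => //.
move=> x /=; rewrite !in_itv/= => /andP[ax xb].
by rewrite (le_trans a0 (ltW ax)) (le_trans xb bn).
Qed.

Let etaN_bounds_oc a b : 0 <= a -> b <= n ->
  forall u, a < u <= b -> 0 <= etaN zeta eta0 N u <= eta0.
Proof.
move=> a0 bn u /andP[au ub]; apply: etaN_bounds.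
by rewrite (le_trans a0 (ltW au)) (le_trans ub bn).
Qed.

Lemma intr_timeB a b : 0 <= a -> a <= b -> b <= n ->
  t b - t a = \int[mu]_(u in `]a, b]) etaN zeta eta0 N u.
Proof.
move=> a0 ab bn; rewrite /t /intr_time Rintegral_itvB ?bnd_simp//.
apply: (@integrable_bounded_itv _ _ _ _ _ _ eta0).
  apply: measurable_funS measurable_etaN => //.
  by move=> x /=; rewrite !in_itv/= => /andP[-> /le_trans]; exact.
move=> u /=; rewrite in_itv/= => /andP[u0 ub]; apply: etaN_bounds.
by rewrite u0 (le_trans ub bn).
Qed.

Lemma intr_time0 : t 0 = 0.
Proof. by rewrite /t /intr_time set_itv1 Rintegral_set1. Qed.

Lemma intr_time_le a b : 0 <= a -> a <= b -> b <= n -> t a <= t b.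
Proof.
move=> a0 ab bn; rewrite -subr_ge0 intr_timeB//.
apply: Rintegral_ge0 => u /=; rewrite in_itv/= => uab.
by have /andP[] := etaN_bounds_oc a0 bn uab.
Qed.

Lemma intr_time_lip a b : 0 <= a -> a <= b -> b <= n -> t b - t a <= eta0 * (b - a).
Proof.
move=> a0 ab bn; rewrite intr_timeB//; apply: Rintegral_itvoc_le => //.
  exact: measurable_etaN_oc.
exact: etaN_bounds_oc.
Qed.

Lemma TN_le : T <= eta0 * n.
Proof.
have := intr_time_lip (lexx 0) (ltW n_gt0) (lexx _).
by rewrite intr_time0 !subr0.
Qed.

(** * The generalized inverse of intrinsic time and the rate [phi] *)

Let level tau := [set z : R | 0 <= z <= n /\ tau <= t z].

Let level_n tau : tau <= T -> level tau n.
Proof. by move=> tauT; split => //; rewrite lexx ltW. Qed.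

Let level_lb tau : lbound (level tau) 0.
Proof. by move=> z [/andP[]]. Qed.

Let level_has_inf tau : tau <= T -> has_inf (level tau).
Proof. by move=> tauT; split; [exists n; exact: level_n|exists 0; exact: level_lb]. Qed.

Lemma zinv_bounds tau : tau <= T -> 0 <= zinv zeta eta0 N tau <= n.
Proof.
move=> tauT; apply/andP; split.
  by apply: lb_le_inf; [exists n; exact: level_n|exact: level_lb].
by apply: ge_inf; [exists 0; exact: level_lb|exact: level_n].
Qed.

Lemma zinv_le tau tau' : tau <= tau' -> tau' <= T ->
  zinv zeta eta0 N tau <= zinv zeta eta0 N tau'.
Proof.
move=> tt' t'T; apply: lb_le_inf; first by exists n; exact: level_n.
move=> z [zn t'z]; apply: ge_inf; first by exists 0; exact: level_lb.
by split => //; exact: le_trans t'z.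
Qed.

(** [t] may have flat pieces, but it is Lipschitz with constant [eta0]. Points just left of the
    infimum have time below [tau], and points of the level set come arbitrarily close to it from the
    right; continuity then forces equality. *)
Lemma intr_time_zinv tau : 0 <= tau <= T -> t (zinv zeta eta0 N tau) = tau.
Proof.
move=> /andP[tau0 tauT]; set z := zinv zeta eta0 N tau.
have /andP[z0 zn] : 0 <= z <= n := zinv_bounds tauT.
apply/eqP; rewrite eq_le; apply/andP; split; apply/ler_addgt0Pr => e e0.
  have [->|zN0] := eqVneq z 0; first by rewrite intr_time0 addr_ge0// ltW.
  have z_gt0 : 0 < z by rewrite lt_def zN0.
  (* [z - d] is nonnegative and lies below the infimum, hence outside the level set; returning to
     [z] costs at most [eta0 * d <= e]. *)
  set d := Num.min z (e / eta0).
  have d_gt0 : 0 < d by rewrite lt_min z_gt0 divr_gt0.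
  have dz : d <= z by rewrite ge_min lexx.
  have de : eta0 * d <= e.
    by rewrite -ler_pdivlMl// mulrC ge_min lexx orbT.
  have w0 : 0 <= z - d by rewrite subr_ge0.
  have wz : z - d <= z by rewrite gerBl ltW.
  have wtau : t (z - d) < tau.
    rewrite ltNge; apply/negP => tauw.
    have : z <= z - d.
      apply: ge_inf; first by exists 0; exact: level_lb.
      by split; rewrite // w0 (le_trans wz zn).
    by rewrite leNgt ltrBlDr ltrDl d_gt0.
  have := intr_time_lip w0 wz zn.
  by rewrite opprB addrCA subrr addr0; lra.
have d_gt0 : 0 < e / eta0 by rewrite divr_gt0.
have [w [/andP[w0 wn] tauw] wz] := inf_adherent d_gt0 (level_has_inf tauT).
have zw : z <= w by apply: ge_inf; [exists 0; exact: level_lb|split; rewrite // w0 wn].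
have := intr_time_lip z0 zw wn.
have : eta0 * (w - z) <= e.
  by rewrite -ler_pdivlMl// mulrC lerBlDl ltW.
lra.
Qed.

Lemma phi_bounds tau : tau <= T -> 0 <= phi zeta eta0 N tau <= eta0.
Proof. by move=> tauT; apply: etaN_bounds; exact: zinv_bounds. Qed.

Lemma measurable_phi : measurable_fun (`[0, T] : set R) (phi zeta eta0 N).
Proof.
(* Past [T] the level set is empty and its [inf] defaults to 0, which would break monotonicity.
   Capping at [T] makes the inverse nondecreasing on the whole line without changing it on
   [[0, T]]. *)
pose w tau := zinv zeta eta0 N (Num.min tau T).
apply: (@eq_measurable_fun _ _ _ _ _ (etaN zeta eta0 N \o w)).
  move=> tau; rewrite inE/= in_itv/= => /andP[_ tauT].
  by rewrite /phi /w /= min_l.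
apply: (@measurable_comp _ _ _ _ _ _ (`[0, n] : set R)) => //.
- move=> _ [tau /= _ <-]; rewrite in_itv/=; apply: zinv_bounds.
  by rewrite ge_min lexx orbT.
- exact: measurable_etaN.
- apply: nondecreasing_measurable => // x y xy; apply: zinv_le.
    by rewrite le_min !ge_min lexx xy orbT.
  by rewrite ge_min lexx orbT.
Qed.

(** * Power-law comparisons in the tail *)

Variables gamma delta c1 c2 : R.
Hypotheses (gamma_gt0 : 0 < gamma) (delta01 : 0 < delta < 1).
Hypotheses (c1_gt0 : 0 < c1) (c2_gt0 : 0 < c2).
Hypothesis zeta_tail : forall x, delta <= x <= 1 ->
  c1 * (1 - x) `^ gamma <= zeta x /\ zeta x <= c2 * (1 - x) `^ gamma.

(** The power of 1/2 is the price of keeping only half of the remaining interval: exponent 1 for its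
    length, exponent [gamma] for the size of the profile on it. *)
Let k1 : R := c1 * (2^-1) `^ (gamma + 1).

Let powRS y : 0 <= y -> y `^ (gamma + 1) = y * y `^ gamma.
Proof.
by move=> y0; rewrite powRD ?powRr1// 1?mulrC// gt_eqF// addr_gt0.
Qed.

(** [1 - u / n] decreases in [u], so its value at [z] controls the integrand, and the length
    [n - z = n (1 - z / n)] supplies the extra power. *)
Lemma remaining_time_le z : delta * n <= z -> z <= n ->
  T - t z <= c2 * (eta0 * n) * (1 - z / n) `^ (gamma + 1).
Proof.
move=> dz zn; have /andP[d0 d1] := delta01.
have z0 : 0 <= z by rewrite (le_trans _ dz)// mulr_ge0 ?ltW.
have zn1 : z / n <= 1 by rewrite ler_pdivrMr ?mul1r.
rewrite /T /TN intr_timeB// powRS ?subr_ge0//.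
have -> : c2 * (eta0 * n) * ((1 - z / n) * (1 - z / n) `^ gamma) =
  eta0 * c2 * (1 - z / n) `^ gamma * (n - z).
  by field; rewrite gt_eqF.
apply: Rintegral_itvoc_le => //; first exact: measurable_etaN_oc.
move=> u uzn; have /andP[-> _] /= := etaN_bounds_oc z0 (lexx _) uzn.
have /andP[zu un] := uzn.
have un1 : u / n <= 1 by rewrite ler_pdivrMr ?mul1r.
rewrite /etaN -!mulrA ler_pM2l//.
have /zeta_tail[_ /le_trans] : delta <= u / n <= 1.
  by rewrite un1 ler_pdivlMr// (le_trans dz (ltW zu)).
apply; rewrite ler_pM2l//; apply: ge0_ler_powR.
- exact: ltW.
- by rewrite nnegrE subr_ge0.
- by rewrite nnegrE subr_ge0.
- by rewrite lerD2l lerN2 ler_pM2r ?invr_gt0// ltW.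
Qed.

(* Only the first half of the remaining interval is used; there [1 - u / n] is at least half of [1 - z / n]. *)
Lemma remaining_time_ge z : delta * n <= z -> z <= n ->
  k1 * (eta0 * n) * (1 - z / n) `^ (gamma + 1) <= T - t z.
Proof.
move=> dz zn; have /andP[d0 d1] := delta01.
have z0 : 0 <= z by rewrite (le_trans _ dz)// mulr_ge0 ?ltW.
have zn1 : z / n <= 1 by rewrite ler_pdivrMr ?mul1r.
pose m := (z + n) / 2.
have zm : z <= m by rewrite /m; lra.
have mn : m <= n by rewrite /m; lra.
have m0 : 0 <= m := le_trans z0 zm.
apply: (@le_trans _ _ (t m - t z)); last first.
  by rewrite lerD2r; exact: intr_time_le.
rewrite intr_timeB//.
have -> : k1 * (eta0 * n) * (1 - z / n) `^ (gamma + 1) =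
    eta0 * c1 * ((1 - z / n) / 2) `^ gamma * (m - z).
  rewrite powRM ?subr_ge0 ?invr_ge0// /k1 !powRS ?subr_ge0 ?invr_ge0//.
  by rewrite /m; field; rewrite gt_eqF.
apply: (@Rintegral_itvoc_ge _ _ _ _ _ eta0) => //.
- exact: measurable_etaN_oc.
- exact: etaN_bounds_oc.
- by rewrite !mulr_ge0 ?powR_ge0// ltW.
- move=> u /andP[zu um].
  have un : u <= n := le_trans um mn.
  have un1 : u / n <= 1 by rewrite ler_pdivrMr ?mul1r.
  rewrite /etaN -!mulrA ler_pM2l//.
  have /zeta_tail[+ _] : delta <= u / n <= 1.
    by rewrite un1 ler_pdivlMr// (le_trans dz (ltW zu)).
  apply: le_trans; rewrite ler_pM2l//; apply: ge0_ler_powR.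
  + exact: ltW.
  + by rewrite nnegrE divr_ge0 ?subr_ge0.
  + by rewrite nnegrE subr_ge0.
  + have : u / n <= m / n by rewrite ler_pM2r ?invr_gt0.
    have -> : m / n = (z / n + 1) / 2 by rewrite /m; field; rewrite gt_eqF.
    lra.
Qed.

(** A lower bound, in units of [eta0 * n], for the intrinsic time spent in the tail. Since
    [T <= eta0 * n], the tail also takes at least the fraction [k] of [T]. *)
Let k : R := k1 * (1 - delta) `^ (gamma + 1).
Let p : R := gamma / (gamma + 1).

Let k_gt0 : 0 < k.
Proof.
have /andP[d0 d1] := delta01.
by rewrite !mulr_gt0// powR_gt0// ?invr_gt0// subr_gt0.
Qed.

Let p_ge0 : 0 <= p.
Proof. by rewrite divr_ge0// ltW// addr_gt0. Qed.

Let powR_tail y : y `^ gamma = (y `^ (gamma + 1)) `^ p.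
Proof.
by rewrite -powRrM /p mulrCA mulfV ?mulr1// gt_eqF// addr_gt0.
Qed.

Lemma tail_time_ge : k * (eta0 * n) <= T - t (delta * n).
Proof.
have /andP[d0 d1] := delta01.
have := @remaining_time_ge (delta * n) (lexx _).
rewrite mulfK ?gt_eqF// /k mulrAC; apply.
by rewrite ler_piMl// ltW.
Qed.

Let dn_ge0 : 0 <= delta * n.
Proof. by have /andP[d0 d1] := delta01; rewrite mulr_ge0 ?ltW. Qed.

Lemma TN_ge : k * (eta0 * n) <= T.
Proof.
apply: le_trans tail_time_ge _; rewrite gerBl -[leLHS]intr_time0.
apply: intr_time_le => //; have /andP[d0 d1] := delta01.
by rewrite ler_piMl// ltW.
Qed.

Let T_gt0 : 0 < T.
Proof. by apply: lt_le_trans TN_ge; rewrite mulr_gt0// mulr_gt0. Qed.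

Lemma tail_fraction_le1 : k <= 1.
Proof.
rewrite -(ler_pM2r T_gt0) mul1r; apply: le_trans TN_ge.
by rewrite ler_pM2l//; exact: TN_le.
Qed.

(** If the inverse fell before [delta * n], then [tau <= t (delta * n) <= T - k * T]. Using [k / 2]
    instead of [k] makes this a strict contradiction. *)
Let zinv_tail tau : T - k / 2 * T <= tau -> tau <= T ->
  [/\ 0 <= tau, delta * n <= zinv zeta eta0 N tau & zinv zeta eta0 N tau <= n].
Proof.
move=> Ttau tauT; have k1' := tail_fraction_le1.
have kT0 : 0 < k * T by rewrite mulr_gt0.
have kTT : k * T <= T by rewrite ler_piMl// ltW.
have tau0 : 0 <= tau by lra.
have /andP[z0 zn] : 0 <= zinv zeta eta0 N tau <= n := zinv_bounds tauT.
split => //; rewrite leNgt; apply/negP => zd.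
have := intr_time_le z0 (ltW zd) _; rewrite intr_time_zinv ?tau0//.
have := tail_time_ge.
have : k * T <= k * (eta0 * n) by rewrite ler_pM2l//; exact: TN_le.
have /andP[d0 d1] := delta01.
have dn : delta * n <= n by rewrite ler_piMl// ltW.
by move=> ? ? /(_ dn); lra.
Qed.

(** The upper bound on the remaining time bounds [(1 - x)^(gamma + 1)] below by
    [(T - tau) / (c2 * (eta0 * n))]; replacing [eta0 * n] by the larger [T / k] produces the factor
    [k / c2]. *)
Lemma phi_tail_ge tau : T - k / 2 * T <= tau -> tau <= T ->
  eta0 * (c1 * (k / c2) `^ p) * ((T - tau) / T) `^ p <= phi zeta eta0 N tau.
Proof.
move=> Ttau tauT; have [tau0 dz zn] := zinv_tail Ttau tauT.
have := remaining_time_le dz zn; rewrite intr_time_zinv ?tau0// => le1.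
rewrite /phi /etaN -mulrA ler_pM2l//; set x := zinv _ _ _ _ / n in le1 *.
have x1 : x <= 1 by rewrite ler_pdivrMr ?mul1r.
have /zeta_tail[+ _] : delta <= x <= 1 by rewrite x1 ler_pdivlMr ?dz.
have kc0 : 0 <= k / c2 by rewrite divr_ge0// ltW.
have u0 : 0 <= (T - tau) / T by rewrite divr_ge0 ?subr_ge0// ltW.
apply: le_trans; rewrite -mulrA ler_pM2l// powR_tail -powRM//.
apply: ge0_ler_powR => //; rewrite ?nnegrE ?powR_ge0//.
  by rewrite mulr_ge0.
rewrite mulf_div ler_pdivrMr ?mulr_gt0//.
apply: (@le_trans _ _ (k * (c2 * (eta0 * n) * (1 - x) `^ (gamma + 1)))).
  by rewrite ler_pM2l.
have -> : k * (c2 * (eta0 * n) * (1 - x) `^ (gamma + 1)) =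
  (1 - x) `^ (gamma + 1) * (c2 * (k * (eta0 * n))) by ring.
apply: ler_wpM2l; first exact: powR_ge0.
by rewrite ler_pM2l//; exact: TN_ge.
Qed.

(** The constant is a sum so as to cover two ranges: the first term serves the tail, through the
    lower bound on the remaining time and [T <= eta0 * n]; the second serves all earlier times. *)
Lemma phi_le tau : 0 <= tau <= T ->
  phi zeta eta0 N tau <=
    eta0 * (c2 * (k1^-1) `^ p + ((k / 2)^-1) `^ p) * ((T - tau) / T) `^ p.
Proof.
move=> /andP[tau0 tauT]; have k1_gt0 : 0 < k1 by rewrite mulr_gt0// powR_gt0// invr_gt0.
have u0 : 0 <= (T - tau) / T by rewrite divr_ge0 ?subr_ge0// ltW.
have k10 : 0 <= k1^-1 by rewrite invr_ge0 ltW.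
have k20 : 0 <= (k / 2)^-1 by rewrite invr_ge0 divr_ge0// ltW.
have [Ttau|tauT'] := leP (T - k / 2 * T) tau.
  have [_ dz zn] := zinv_tail Ttau tauT.
  have := remaining_time_ge dz zn; rewrite intr_time_zinv ?tau0// => le1.
  rewrite /phi /etaN -mulrA ler_pM2l//; set x := zinv _ _ _ _ / n in le1 *.
  have x1 : x <= 1 by rewrite ler_pdivrMr ?mul1r.
  have /zeta_tail[_ +] : delta <= x <= 1 by rewrite x1 ler_pdivlMr ?dz.
  move/le_trans; apply; rewrite mulrDl; apply: ler_wpDr.
    by rewrite mulr_ge0// powR_ge0.
  rewrite -mulrA ler_pM2l// powR_tail -powRM//.
  apply: ge0_ler_powR => //; rewrite ?nnegrE ?powR_ge0//.
    by rewrite mulr_ge0.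
  rewrite mulrC -mulrA -invfM ler_pdivlMr ?mulr_gt0//.
  apply: le_trans le1; rewrite mulrC; apply: ler_wpM2r; first exact: powR_ge0.
  by rewrite mulrC ler_pM2l//; exact: TN_le.
(* Here [(T - tau) / T > k / 2], so the second term alone already makes the right-hand side at least
   [eta0]. *)
have /andP[_ /le_trans] := phi_bounds tauT; apply.
rewrite -mulrA ler_peMr ?(ltW eta0_gt0)// mulrDl; apply: ler_wpDl.
  by rewrite mulr_ge0 ?powR_ge0// mulr_ge0 ?powR_ge0// ltW.
rewrite -powRM// [leLHS](_ : 1 = 1 `^ p); last by rewrite powR1.
apply: ge0_ler_powR => //; rewrite ?nnegrE//.
  by rewrite mulr_ge0.
rewrite mulrC ler_pdivlMr ?divr_gt0// mul1r ler_pdivlMr//; lra.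
Qed.

End intrinsic_time.

(** * The kernel integrated against a power-law rate *)

Section kernel_integral.
Variable R : realType.
Notation mu := (@lebesgue_measure R).
Variables (beta T p : R) (f : R -> R).
Hypotheses (beta_gt1 : 1 < beta) (T_ge2 : 2 <= T) (p_ge0 : 0 <= p).
Hypothesis mf : measurable_fun (`[0, T] : set R) f.
Let r : R := 2 - beta^-1.
(** Kernel decay [u^(-r)] times rate [u^p] is [u^(q - 1)], the integrand of [pow_primitive q]. *)
Let q : R := p - r + 1.

Let r_gt0 : 0 < r.
Proof.
rewrite /r subr_gt0; apply: (@lt_trans _ _ 1); last by rewrite ltr1n.
by rewrite invf_lt1// (lt_trans _ beta_gt1).
Qed.

Let T_gt0 : 0 < T. Proof. exact: lt_le_trans T_ge2. Qed.

Lemma kernelK_ge0_le1 u : 0 <= u -> 0 <= kernelK beta u <= 1.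
Proof.
move=> u0; rewrite powR_ge0/= /kernelK -/r -[leRHS](powRr0 (1 + u)).
by apply: ler_powR; [rewrite lerDl|rewrite oppr_le0 ltW].
Qed.

Lemma measurable_kernelK : measurable_fun (`[0, T] : set R) (fun tau => kernelK beta (T - tau)).
Proof.
apply: (@measurableT_comp _ _ _ _ _ _ (@powR R ^~ (- r))).
  exact: measurable_powR.
apply: measurable_funD; first exact: measurable_cst.
by apply: measurable_funB; first exact: measurable_cst.
Qed.

Variable M : R.
Hypothesis fM : forall tau, 0 <= tau <= T -> 0 <= f tau <= M.

Lemma integrable_kernelKM :
  mu.-integrable `[0, T] (EFin \o (fun tau => kernelK beta (T - tau) * f tau)).
Proof.
apply: (@integrable_bounded_itv _ _ _ _ _ _ M).
  by apply: measurable_funM => //; exact: measurable_kernelK.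
move=> u /=; rewrite in_itv/= => uT; have /andP[u0 uM] := fM uT.
have /andP[_ uT'] := uT.
have /andP[K0 K1] : 0 <= kernelK beta (T - u) <= 1.
  by apply: kernelK_ge0_le1; rewrite subr_ge0.
by rewrite mulr_ge0//= (le_trans _ uM)// ler_piMl.
Qed.

(** In the variable [1 + T - tau] the kernel is an exact power, and [p >= 0] allows [T - tau] in the
    rate to be enlarged to that variable. What remains is a pure power on [[1, 1 + T]], away from
    the singularity at 0. *)
Lemma kernel_integral_le A : 0 <= A ->
  (forall tau, 0 <= tau <= T -> f tau <= A * ((T - tau) / T) `^ p) ->
  \int[mu]_(tau in `[0, T]) (kernelK beta (T - tau) * f tau) <=
  A * T `^ (- p) * (pow_primitive q (1 + T) - pow_primitive q 1).
Proof.
move=> A0 fA.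
have TT : T < 1 + T by rewrite ltrDr.
have -> : pow_primitive q (1 + T) - pow_primitive q 1 =
    \int[mu]_(tau in `[0, T]) (1 + T - tau) `^ (q - 1).
  by rewrite Rintegral_pow_refl// subr0 addrK.
rewrite -RintegralZl//; last exact: integrable_pow_refl.
apply: le_Rintegral => //.
- exact: integrable_kernelKM.
- exact: integrable_scale_pow_refl.
move=> tau /=; rewrite in_itv/= => tauT; have /andP[tau0 tauT'] := tauT.
have u0 : 0 <= T - tau by rewrite subr_ge0.
apply: (@le_trans _ _ (kernelK beta (T - tau) * (A * ((T - tau) / T) `^ p))).
  by apply: ler_wpM2l; [exact: powR_ge0|exact: fA].
rewrite /kernelK -/r mulrCA -mulrA; apply: ler_wpM2l => //.
have Ti0 : 0 <= T^-1 by rewrite invr_ge0 ltW.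
rewrite powRM// -powR_inv1 ?(ltW T_gt0)// -powRrM mulN1r.
rewrite mulrA mulrC; apply: ler_wpM2l; first exact: powR_ge0.
have -> : q - 1 = - r + p by rewrite /q; ring.
rewrite -addrA powRD; last by apply/implyP => _; rewrite gt_eqF// ltr_wpDr.
apply: ler_wpM2l; first exact: powR_ge0.
by apply: ge0_ler_powR; rewrite // ?nnegrE ?lerDr// addr_ge0.
Qed.

(* Restricting to [tau <= T - k] gives [1 + u <= (1 + 1/k) u] for [u = T - tau], so the kernel is comparable to a pure power of [u] there. *)
Lemma kernel_integral_ge A k : 0 <= A -> 0 < k <= 1 ->
  (forall tau, T - k * T <= tau <= T -> A * ((T - tau) / T) `^ p <= f tau) ->
  A * (1 + k^-1) `^ (- r) * T `^ (- p) * (pow_primitive q (k * T) - pow_primitive q k) <=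
  \int[mu]_(tau in `[0, T]) (kernelK beta (T - tau) * f tau).
Proof.
move=> A0 /andP[k0 k1] fA.
have kT : k * T <= T by rewrite ler_piMl// ltW.
(* [T >= 2] makes the interval [[T - k * T, T - k]] nondegenerate. *)
have k2 : k * 2 <= k * T by rewrite ler_pM2l.
have TkT : T - k * T < T - k by lra.
have TkT' : T - k < T by rewrite gtrBl.
have -> : pow_primitive q (k * T) - pow_primitive q k =
    \int[mu]_(tau in `[T - k * T, T - k]) (T - tau) `^ (q - 1).
  by rewrite Rintegral_pow_refl// !subKr.
have sub : `[T - k * T, T - k] `<=` (`[0, T] : set R).
  by move=> x /=; rewrite !in_itv/= => /andP[? ?]; apply/andP; split; lra.
apply: (@le_trans _ _ (\int[mu]_(tau in `[T - k * T, T - k]) (kernelK beta (T - tau) * f tau))); last first.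
  apply: ge0_le_Rintegral_subset => //; first exact: integrable_kernelKM.
  move=> u /=; rewrite in_itv/= => /fM/andP[fu _].
  by rewrite mulr_ge0// powR_ge0.
rewrite -RintegralZl//; last exact: integrable_pow_refl.
apply: le_Rintegral => //.
- exact: integrable_scale_pow_refl.
- by apply: integrableS integrable_kernelKM.
move=> tau /=; rewrite in_itv/= => /andP[tau1 tau2].
have uk : k <= T - tau by lra.
have u0 : 0 < T - tau by apply: lt_le_trans uk.
apply: (@le_trans _ _ (kernelK beta (T - tau) * (A * ((T - tau) / T) `^ p))); last first.
  apply: ler_wpM2l; first exact: powR_ge0.
  by apply: fA; apply/andP; split; lra.
rewrite /kernelK -/r [leRHS]mulrCA -!mulrA; apply: ler_wpM2l => //.
have Ti0 : 0 <= T^-1 by rewrite invr_ge0 ltW.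
have ki0 : 0 < k^-1 by rewrite invr_gt0.
rewrite powRM// ?(ltW u0)// -powR_inv1 ?(ltW T_gt0)// -powRrM mulN1r.
have -> : q - 1 = - r + p by rewrite /q; ring.
rewrite powRD; last by apply/implyP => _; rewrite gt_eqF.
rewrite [leLHS](_ : _ = ((1 + k^-1) `^ (- r) * (T - tau) `^ (- r)) * ((T - tau) `^ p * T `^ (- p))); last by ring.
apply: ler_wpM2r; first by rewrite mulr_ge0// powR_ge0.
have ki1 : 0 < 1 + k^-1 by rewrite addr_gt0.
rewrite -powRM ?(ltW ki1) ?(ltW u0)// !powRN.
rewrite lef_pV2 ?posrE; [|by rewrite powR_gt0// mulr_gt0|by rewrite powR_gt0// addr_gt0].
apply: ge0_ler_powR; rewrite ?nnegrE.
- exact: ltW.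
- by rewrite addr_ge0// (ltW u0).
- by rewrite mulr_ge0// ltW.
- by rewrite mulrDl mul1r addrC lerD2l mulrC ler_pdivlMr// mul1r.
Qed.

End kernel_integral.

(** * Growth of the power integral and identification of the rate *)

Section gain.
Variable R : realType.

(** The order of the integral of [u^(q - 1)] from 1 to [T]: power growth, logarithmic growth or
    convergence, according to the sign of [q]. *)
Definition kernel_gain (q T : R) : R :=
  if 0 < q then T `^ q else if q == 0 then ln T else 1.

Lemma kernel_gain_gt0 (q T : R) : 2 <= T -> 0 < kernel_gain q T.
Proof.
move=> T2; rewrite /kernel_gain; case: ifP => _; first by rewrite powR_gt0// (lt_le_trans _ T2).
by case: ifP => // _; rewrite ln_gt0// (lt_le_trans _ T2)// ltr1n.
Qed.

Lemma powR2_gt1 (q : R) : 0 < q -> 1 < 2 `^ q.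
Proof.
move=> q0; rewrite [ltLHS](_ : 1 = 1 `^ q); last by rewrite powR1.
by apply: gt0_ltr_powR => //; rewrite ?nnegrE// ltr1n.
Qed.

(** For [q > 0], use [1 + T <= 2 T]. For [q < 0], the integral over [[1, oo)] converges to
    [- 1 / q]. For [q = 0], use [1 + T <= T^2], valid once [T >= 2]. *)
Lemma pow_primitive_le_gain (q : R) : exists2 C : R, 0 < C & forall T, 2 <= T ->
  pow_primitive q (1 + T) - pow_primitive q 1 <= C * kernel_gain q T.
Proof.
rewrite /pow_primitive /kernel_gain.
have [q0|q0|_] := ltgtP 0 q.
- exists (2 `^ q / q) => [|T T2]; first by rewrite divr_gt0// powR_gt0.
  have T0 : 0 <= T by rewrite (le_trans _ T2).
  rewrite -mulrBl mulrAC ler_pM2r ?invr_gt0// -powRM// powR1.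
  apply: (@le_trans _ _ ((1 + T) `^ q)); first by rewrite gerBl.
  apply: ge0_ler_powR; rewrite ?nnegrE ?(ltW q0) ?addr_ge0 ?mulr_ge0//.
  by rewrite mulrDl mul1r lerD2r (le_trans _ T2)// ler1n.
- exists (- q^-1) => [|T T2]; first by rewrite oppr_gt0 invr_lt0.
  rewrite powR1 mulr1 -mulrBl -opprB mulNr -mulrN mulrC -[leRHS]mulr1.
  rewrite ler_pM2l ?oppr_gt0 ?invr_lt0// gerBl; exact: powR_ge0.
- exists 2 => // T T2.
  rewrite ln1 subr0 -ln_powR.
  have T0 : 0 < T by rewrite (lt_le_trans _ T2).
  rewrite ler_ln ?posrE ?powR_gt0 ?addr_gt0//.
  rewrite powR_mulrn ?(ltW T0)//; nra.
Qed.

(** [T >= 2] keeps the difference away from 0: [T^q - 1 >= (1 - 2^(-q)) T^q] for [q > 0], and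
    [1 - T^q >= 1 - 2^q] for [q < 0]. For [q = 0] the difference is exactly [ln T]. *)
Lemma pow_primitive_ge_gain (q k : R) : 0 < k ->
  exists2 c : R, 0 < c & forall T, 2 <= T ->
  c * kernel_gain q T <= pow_primitive q (k * T) - pow_primitive q k.
Proof.
move=> k0; rewrite /pow_primitive /kernel_gain.
have [q0|q0|_] := ltgtP 0 q.
- exists (k `^ q / q * (1 - 2 `^ (- q))) => [|T T2].
    rewrite mulr_gt0 ?divr_gt0 ?powR_gt0// subr_gt0 powRN invf_lt1 ?powR_gt0//.
    exact: powR2_gt1.
  have T0 : 0 <= T by rewrite (le_trans _ T2).
  rewrite -mulrBl powRM// ?(ltW k0)//.
  have -> : (k `^ q * T `^ q - k `^ q) / q = k `^ q / q * (T `^ q - 1) by ring.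
  rewrite -mulrA ler_pM2l ?divr_gt0 ?powR_gt0//.
  rewrite mulrBl mul1r lerD2l lerN2 powRN mulrC ler_pdivlMr ?powR_gt0// mul1r.
  by apply: ge0_ler_powR => //; exact: ltW.
- exists (k `^ q * - q^-1 * (1 - 2 `^ q)) => [|T T2].
    rewrite !mulr_gt0 ?powR_gt0 ?oppr_gt0 ?invr_lt0// subr_gt0.
    by rewrite -[q]opprK powRN invf_lt1 ?powR_gt0// powR2_gt1// oppr_gt0.
  have T0 : 0 <= T by rewrite (le_trans _ T2).
  rewrite mulr1 powRM// ?(ltW k0)//.
  have -> : k `^ q * T `^ q / q - k `^ q / q = k `^ q * - q^-1 * (1 - T `^ q) by ring.
  rewrite ler_pM2l ?mulr_gt0 ?powR_gt0 ?oppr_gt0 ?invr_lt0//.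
  rewrite lerD2l lerN2 -[q]opprK [leLHS]powRN [leRHS]powRN.
  rewrite lef_pV2 ?posrE ?powR_gt0 ?(lt_le_trans _ T2)//.
  by apply: ge0_ler_powR; rewrite ?nnegrE// oppr_ge0 ltW.
- exists 1 => // T T2.
  have T0 : 0 < T by rewrite (lt_le_trans _ T2).
  by rewrite mul1r lnM ?posrE// addrAC subrr add0r.
Qed.

(** The gain exponent is positive exactly when [beta < gamma + 1]; adding it to
    [- (1 - 1 / (gamma + 1))] then leaves [- (1 - 1 / beta)]. Otherwise the prefactor already has
    the right exponent, and the logarithm survives only at equality. *)
Lemma kernel_gain_rate (beta gamma T : R) : 1 < beta -> 0 < gamma -> 0 < T ->
  T `^ (- (gamma / (gamma + 1))) * kernel_gain (beta^-1 - (gamma + 1)^-1) T =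
  T `^ (- (1 - (Num.min beta (gamma + 1))^-1)) *
    (if beta == gamma + 1 then ln T else 1).
Proof.
move=> b1 g0 T0; rewrite /kernel_gain.
have b0 : 0 < beta by rewrite (lt_trans _ b1).
have g10 : 0 < gamma + 1 by rewrite addr_gt0.
have pE : gamma / (gamma + 1) = 1 - (gamma + 1)^-1 by field; rewrite gt_eqF.
rewrite pE subr_gt0 subr_eq0 ltf_pV2 ?posrE// (inj_eq invr_inj).
have [bg|bg|->] := ltgtP beta (gamma + 1).
- rewrite mulr1 -powRD; last by apply/implyP => _; rewrite gt_eqF.
  by congr (T `^ _); ring.
- by rewrite mulr1.
- by [].
Qed.

Lemma powR_shift_bounds (s T : R) : 0 < s -> 2 <= T ->
  2 `^ (- s) * T `^ (- s) <= (1 + T) `^ (- s) <= T `^ (- s).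
Proof.
move=> s0 T2; have T0 : 0 < T by rewrite (lt_le_trans _ T2).
rewrite -powRM ?(ltW T0)// !powRN !lef_pV2 ?posrE ?powR_gt0 ?mulr_gt0 ?addr_gt0//.
apply/andP; split; apply: ge0_ler_powR; rewrite ?nnegrE ?(ltW s0) ?(ltW T0) ?addr_ge0 ?mulr_ge0 ?(ltW T0)//.
  by rewrite mulrDl mul1r lerD2r (le_trans _ T2)// ler1n.
by rewrite lerDr.
Qed.

End gain.

(** * Assembly of the estimates with constants uniform in [N] and [eta0] *)

Unset Implicit Arguments.

Theorem mainTheorem4 (R : realType) (s beta gamma delta : R) (zeta : R -> R) :
  0 < s -> 1 < beta -> 0 < gamma -> 0 < delta < 1 ->
  power_decay_profile zeta gamma delta ->
  exists c C : R, 0 < c /\ 0 < C /\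
    forall (N : nat) (eta0 : R), (0 < N)%N -> 0 < eta0 ->
      2 <= TN zeta eta0 N ->
      c * riskRHS s beta gamma eta0 (TN zeta eta0 N) <= riskF s beta zeta eta0 N /\
      riskF s beta zeta eta0 N <= C * riskRHS s beta gamma eta0 (TN zeta eta0 N).
Proof.
move=> s0 b1 g0 d01 [mz [z01 [_ [c1 [c2 [c10 [c20 tail]]]]]]].
have /andP[d0 d1] := d01.
(* These repeat the constants of the tail analysis. All are fixed before [N] and [eta0] are
   introduced, which gives the uniformity. *)
pose k1 := c1 * (2^-1) `^ (gamma + 1).
pose k := k1 * (1 - delta) `^ (gamma + 1).
pose p := gamma / (gamma + 1).
pose q := beta^-1 - (gamma + 1)^-1.
pose cu := c2 * (k1^-1) `^ p + ((k / 2)^-1) `^ p.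
pose cl := c1 * (k / c2) `^ p.
have k10 : 0 < k1 by rewrite mulr_gt0// powR_gt0// invr_gt0.
have k0 : 0 < k by rewrite mulr_gt0// powR_gt0// subr_gt0.
have k20 : 0 < k / 2 by rewrite divr_gt0.
have p0 : 0 <= p by rewrite divr_ge0 ?addr_ge0// ltW.
have qE : p - (2 - beta^-1) + 1 = q.
  by rewrite /q /p; field; rewrite !gt_eqF// ?addr_gt0// (lt_trans _ b1).
have cu0 : 0 < cu.
  by rewrite addr_gt0// ?powR_gt0 ?invr_gt0// mulr_gt0// powR_gt0// invr_gt0.
have cl0 : 0 < cl by rewrite mulr_gt0// powR_gt0// divr_gt0.
have [C0 C00 upper] := pow_primitive_le_gain q.
have [c0 c00 lower] := pow_primitive_ge_gain q k20.
pose cK := cl * (1 + (k / 2)^-1) `^ (- (2 - beta^-1)) * c0.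
have cK0 : 0 < cK.
  by rewrite mulr_gt0// mulr_gt0// powR_gt0// addr_gt0// invr_gt0.
(* Each lower constant handles one summand, [2^(-s)] coming from [1 + T <= 2 T], so their minimum
   serves both. The upper constants 1 and [cu * C0] are simply added. *)
exists (Num.min (2 `^ (- s)) cK), (1 + cu * C0); split.
  by rewrite lt_min powR_gt0//.
split; first by rewrite addr_gt0// mulr_gt0.
move=> N eta0 N0 e0 T2; set T := TN zeta eta0 N in T2 *.
have T0 : 0 < T by rewrite (lt_le_trans _ T2).
have k_le1 : k <= 1 by exact: (tail_fraction_le1 mz z01 N0 e0 g0 d01 c10 tail).
have mphi : measurable_fun (`[0, T] : set R) (phi zeta eta0 N) by exact: measurable_phi.
have phib tau : 0 <= tau <= T -> 0 <= phi zeta eta0 N tau <= eta0.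
  by case/andP => _; exact: phi_bounds.
have phi_upper tau : 0 <= tau <= T -> phi zeta eta0 N tau <= eta0 * cu * ((T - tau) / T) `^ p.
  exact: phi_le.
have phi_lower tau : T - k / 2 * T <= tau <= T -> eta0 * cl * ((T - tau) / T) `^ p <= phi zeta eta0 N tau.
  by case/andP; exact: phi_tail_ge.
rewrite /riskF -/T; set I := \int[_]_(_ in _) _.
have I_le := kernel_integral_le b1 T2 p0 mphi phib (ltW (mulr_gt0 e0 cu0)) phi_upper.
have k2le : 0 < k / 2 <= 1 by apply/andP; split => //; lra.
have I_ge := kernel_integral_ge b1 T2 mphi phib (ltW (mulr_gt0 e0 cl0)) k2le phi_lower.
rewrite -/I qE in I_le I_ge.
(* Both integral bounds are multiples of [eta0 * G], and [kernel_gain_rate] identifies [G] with the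
   claimed rate, so the two sides can be compared summand by summand. *)
pose G := T `^ (- p) * kernel_gain q T.
have -> : riskRHS s beta gamma eta0 T = T `^ (- s) + eta0 * G.
  by rewrite /riskRHS /G kernel_gain_rate// mulrA.
have G0 : 0 < G by rewrite mulr_gt0// ?powR_gt0// kernel_gain_gt0.
have eG0 : 0 < eta0 * G by rewrite mulr_gt0.
have /andP[sl su] := powR_shift_bounds s0 T2.
have Ts0 : 0 < T `^ (- s) by rewrite powR_gt0.
have Iu : I <= cu * C0 * (eta0 * G).
  apply: le_trans I_le _.
  have -> : cu * C0 * (eta0 * G) = eta0 * cu * T `^ (- p) * (C0 * kernel_gain q T).
    by rewrite /G; ring.
  by apply: ler_wpM2l; [rewrite !mulr_ge0 ?powR_ge0// ltW|exact: upper].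
have Il : cK * (eta0 * G) <= I.
  apply: le_trans I_ge.
  have -> : cK * (eta0 * G) =
      eta0 * cl * (1 + (k / 2)^-1) `^ (- (2 - beta^-1)) * T `^ (- p) * (c0 * kernel_gain q T).
    by rewrite /G /cK; ring.
  apply: ler_wpM2l; last exact: lower.
  by do 3 (rewrite mulr_ge0 ?powR_ge0//); exact: ltW.
rewrite !mulrDr; split; apply: lerD.
- by apply: le_trans sl; rewrite ler_pM2r// ge_min lexx.
- by apply: le_trans Il; rewrite ler_pM2r// ge_min lexx orbT.
- by rewrite mulrDl mul1r; apply: ler_wpDr => //; rewrite !mulr_ge0// ltW.
- by rewrite [leRHS]mulrDl mul1r; apply: ler_wpDl => //; exact: ltW.
Qed.
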